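(* Let $K_4^-$ be the $3$-graph on vertex set $\{1,2,3,4\}$ with $3$-edges $123, 124, 134$. For every positive integer $n$, $$\mathrm{co^+ex}(n,K_4^-)=\left\lfloor \frac n3\right\rfloor .$$ Moreover, when $n\equiv 0 \pmod 6$ there are (up to isomorphism) exactly two extremal $n$-vertex $3$-graphs for $K_4^-$, namely the complete balanced $3$-partite $3$-graph on $n$ vertices and the $n$-vertex blow-up of $H_6$ all of whose classes have the same size; when $n\equiv 3\pmod 6$, the unique (up to isomorphism) extremal $n$-vertex $3$-graph for $K_4^-$ is the complete balanced $3$-partite $3$-graph on $n$ vertices.
   Context: An $r$-graph is a finite $r$-uniform hypergraph; an edge is written as the concatenation of its vertices. The minimum positive co-degree $\delta_{r-1}^+(H)$ of a non-empty $r$-graph $H$ is the maximum $k$ such that every $(r-1)$-set of vertices contained in some edge of $H$ is contained in at least $k$ distinct edges of $H$; by convention it is $0$ if $H$ has no edges. A hypergraph is $F$-free if it has no (not necessarily induced) subhypergraph isomorphic to $F$. For an $r$-graph $F$, $\mathrm{co^+ex}(n,F)$ is the maximum of $\delta_{r-1}^+(H)$ over all $n$-vertex $F$-free $r$-graphs $H$. An $n$-vertex $F$-free $r$-graph $H$ is extremal for $F$ if $\delta_{r-1}^+(H)=\mathrm{co^+ex}(n,F)$. The complete balanced $3$-partite $3$-graph on $n$ vertices has its vertex set partitioned into three classes whose sizes differ by at most $1$, and its edges are all triples with exactly one vertex in each class. $H_6$ is the $3$-graph on vertex set $\{1,\dots,6\}$ with edge set $E_6=\{123,124,345,346,561,562,135,146,236,245\}$.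 A blow-up of $H_6$ is a $3$-graph whose vertex set is partitioned as $V_1\cup\dots\cup V_6$ and whose edges are exactly the triples $v_iv_jv_k$ with $v_i\in V_i$, $v_j\in V_j$, $v_k\in V_k$ and $ijk\in E_6$. *)

(* Defs.v *)
From HB Require Import structures.
From mathcomp Require Import all_boot.
Set Implicit Arguments.
Unset Strict Implicit.
Unset Printing Implicit Defensive.

(* Every vertex of V counts, isolated or not: an n-vertex r-graph is, up to
   relabelling, an element of hypergraph r 'I_n. *)
Record hypergraph (r : nat) (V : finType) := Hypergraph {
  edges :> {set {set V}};
  edges_uniform : [forall e in edges, #|e| == r]
}.

HB.instance Definition _ (r : nat) (V : finType) :=
  [isSub for @edges r V].
HB.instance Definition _ (r : nat) (V : finType) :=
  [Finite of hypergraph r V by <:].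

Definition codegree (r : nat) (V : finType) (H : hypergraph r V)
    (S : {set V}) : nat :=
  #|[set e in edges H | S \subset e]|.

(* The bound k <= #|H| only makes the maximum finite: if H has an edge, then
   (for r > 0) some (r-1)-set lies in an edge, and its co-degree is at most
   #|H|.  If H has no edge, the only candidate is k = 0, as the convention
   requires. *)
Definition min_pos_codegree (r : nat) (V : finType) (H : hypergraph r V) :
  nat :=
  \max_(k < #|edges H|.+1 |
        [forall S : {set V},
           (#|S| == r.-1) && [exists e in edges H, S \subset e]
           ==> (k <= codegree H S)]) k.

Definition hfree (r : nat) (W V : finType) (F : hypergraph r W)
    (H : hypergraph r V) : bool :=
  ~~ [exists f : {ffun W -> V},
        injectiveb f &&
        ([set f @: (e : {set W}) | e in edges F] \subset edges H)].

Definition coex (r : nat) (W : finType) (n : nat) (F : hypergraph r W) : nat :=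
  \max_(H : hypergraph r 'I_n | hfree F H) min_pos_codegree H.

Definition extremal (r : nat) (W : finType) (n : nat) (F : hypergraph r W)
    (H : hypergraph r 'I_n) : Prop :=
  hfree F H /\ min_pos_codegree H = coex n F.

Definition isomorphic (r : nat) (V W : finType) (G : hypergraph r V)
    (H : hypergraph r W) : Prop :=
  exists2 f : V -> W, bijective f &
    [set f @: (e : {set V}) | e in edges G] = edges H.

(* A partition of V into classes indexed by I, possibly empty, is given by the
   map c : V -> I sending a vertex to the index of its class. *)
Definition vclass (V I : finType) (c : V -> I) (i : I) : {set V} :=
  [set v | c v == i].

Definition complete_balanced_tripartite (V : finType) (H : hypergraph 3 V) :
  Prop :=
  exists c : V -> 'I_3,
    (forall i j : 'I_3, #|vclass c i| <= #|vclass c j| + 1) /\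
    (forall e : {set V},
       e \in edges H <-> forall i : 'I_3, #|e :&: vclass c i| = 1).

(* The edges of the blow-up are the sets {v i | i \in f} with f an edge of F
   and v i in the class of i for every i \in f. *)
Definition blowup_along (r : nat) (W V : finType) (F : hypergraph r W)
    (c : V -> W) (H : hypergraph r V) : Prop :=
  forall e : {set V},
    e \in edges H <->
    exists f : {set W}, exists v : W -> V,
      [/\ f \in edges F, (forall i, i \in f -> v i \in vclass c i)
        & e = v @: f].

Definition equal_blowup (r : nat) (W V : finType) (F : hypergraph r W)
    (H : hypergraph r V) : Prop :=
  exists c : V -> W,
    (forall i j : W, #|vclass c i| = #|vclass c j|) /\ blowup_along F c H.

(* The vertices 1, ..., n are represented by the ordinals 0, ..., n-1. *)
Definition labelled_edge (n : nat) (s : seq nat) : {set 'I_n} :=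
  [set v : 'I_n | v.+1 \in s].

Definition labelled_edges (n : nat) (l : seq (seq nat)) : {set {set 'I_n}} :=
  [set:: [seq labelled_edge n s | s <- l]].

Lemma labelled_edges_uniform (r n : nat) (l : seq (seq nat)) :
  all (fun s => count (fun m => m.+1 \in s) (iota 0 n) == r) l ->
  [forall e in labelled_edges n l, #|e| == r].
Proof.
move=> /allP l_r; apply/forall_inP => e.
rewrite inE => /mapP[s /l_r /eqP <- ->].
rewrite cardE /enum_mem size_filter -enumT -val_enum_ord count_map.
by apply/eqP/eq_count => v; rewrite /= inE.
Qed.

Definition K4minus : hypergraph 3 'I_4 :=
  Hypergraph (@labelled_edges_uniform 3 4
    [:: [:: 1; 2; 3]; [:: 1; 2; 4]; [:: 1; 3; 4]] isT).

Definition H6 : hypergraph 3 'I_6 :=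
  Hypergraph (@labelled_edges_uniform 3 6
    [:: [:: 1; 2; 3]; [:: 1; 2; 4]; [:: 3; 4; 5]; [:: 3; 4; 6]; [:: 5; 6; 1];
        [:: 5; 6; 2]; [:: 1; 3; 5]; [:: 1; 4; 6]; [:: 2; 3; 6]; [:: 2; 4; 5]]
    isT).

(* Main.v *)
(* Let xyz be an edge of a K_4^- -free 3-graph.  A vertex joined to two of the
   pairs xy, xz, yz would create a K_4^-, so the three neighbourhoods are
   disjoint and the minimum positive co-degree k is at most n/3.

   When n = 3k and this bound is attained, the neighbourhoods of the three pairs
   of any edge partition the vertex set into parts of size k; equivalently, four
   vertices span either no edge or exactly two.  If, for all edges xyz, ayz and
   bxz, abz is also an edge, then the partition attached to one edge makes the
   3-graph complete tripartite.  Otherwise, since the pairs az and xz have the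
   same co-degree, some c is joined to az but not to xz, and the rule on four
   vertices forces a, b, c, x, y, z to span a copy of H_6.  The same rule makes
   every further vertex a twin of a vertex of this copy, so the 3-graph is a
   blow-up of H_6, and the co-degree equations make its classes equal. *)
Require Import Defs.
From mathcomp Require Import all_boot zify.
Set Implicit Arguments.
Unset Strict Implicit.
Unset Printing Implicit Defensive.

(** * Edges as triples, neighbourhoods of pairs, co-degrees *)

Definition edge3 (V : finType) (H : hypergraph 3 V) (x y z : V) : bool :=
  [set x; y; z] \in edges H.

Definition nb (V : finType) (H : hypergraph 3 V) (x y : V) : {set V} :=
  [set w | edge3 H x y w].

Section ThreeGraphs.

Variables (V : finType) (H : hypergraph 3 V).

Lemma edge3_12 x y z : edge3 H x y z = edge3 H y x z.
Proof. by rewrite /edge3 (setUC [set x]). Qed.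

Lemma edge3_23 x y z : edge3 H x y z = edge3 H x z y.
Proof. by rewrite /edge3 setUAC. Qed.

Lemma edge3_13 x y z : edge3 H x y z = edge3 H z y x.
Proof. by rewrite edge3_12 edge3_23 edge3_12. Qed.

Lemma edge3_rot x y z : edge3 H x y z = edge3 H y z x.
Proof. by rewrite edge3_12 edge3_23. Qed.

Lemma edge_card3 e : e \in edges H -> #|e| = 3.
Proof. by move=> eH; apply/eqP; exact: (forall_inP (edges_uniform H)). Qed.

Lemma edge3_uniq x y z : edge3 H x y z -> uniq [:: x; y; z].
Proof.
move=> /edge_card3 h3; apply/card_uniqP => /=; rewrite -h3.
by apply: eq_card => v; rewrite !inE orbA.
Qed.

Lemma edge3_xxz x z : edge3 H x x z = false.
Proof. by apply/negP => /edge3_uniq; rewrite /= inE eqxx. Qed.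

Lemma edge3_xyy x y : edge3 H x y y = false.
Proof. by rewrite edge3_13 edge3_xxz. Qed.

Lemma edge3_neq x y z : edge3 H x y z -> x != y.
Proof. by apply: contraTneq => ->; rewrite edge3_xxz. Qed.

Lemma card3_set (e : {set V}) : #|e| = 3 -> exists x y z, e = [set x; y; z].
Proof.
move=> e3; have /card_gt0P[x xe] : 0 < #|e| by rewrite e3.
have /eqP/cards2P[y [z [_ exz]]] : #|e :\ x| = 2.
  by move: e3; rewrite (cardsD1 x) xe => -[].
by exists x, y, z; rewrite -setUA -exz setD1K.
Qed.

Lemma edge_triple e : e \in edges H ->
  exists x y z, e = [set x; y; z] /\ edge3 H x y z.
Proof.
move=> eH; have [x [y [z exyz]]] := card3_set (edge_card3 eH).
by exists x, y, z; rewrite /edge3 -exyz.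
Qed.

(** Sending [w] to [[set x; y; w]] is a bijection from the neighbourhood onto the edges through the
    pair. For [x = y] the left side would be a vertex degree and the right side 0. *)
Lemma codegree_nb x y : x != y -> codegree H [set x; y] = #|nb H x y|.
Proof.
move=> xy; rewrite /codegree.
have inj : {in nb H x y &, injective (fun w => [set x; y; w])}.
  move=> u w; rewrite !inE => /edge3_uniq /= uq _ euw.
  have : u \in [set x; y; w] by rewrite -euw !inE eqxx !orbT.
  move: uq; rewrite !inE => /and3P[/norP[_ xu] yu _] /orP[/orP[]|] /eqP // uE.
    by rewrite uE eqxx in xu.
  by rewrite uE eqxx in yu.
rewrite -(card_in_imset inj); apply: eq_card => e; rewrite inE.
apply/andP/imsetP => [[eH /subsetP sub]|[w]].
  have xe : x \in e by apply: sub; rewrite !inE eqxx.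
  have ye : y \in e by apply: sub; rewrite !inE eqxx orbT.
  have /eqP/cards1P[w ew] : #|e :\ x :\ y| = 1.
    have := edge_card3 eH; rewrite (cardsD1 x) xe (cardsD1 y) !inE eq_sym xy ye.
    by case.
  have eE : e = [set x; y; w] by rewrite -setUA -ew !setD1K // !inE eq_sym xy.
  by exists w; rewrite // inE /edge3 -eE.
by rewrite inE /edge3 => h ->; split=> //; apply: subsetUl.
Qed.

Lemma min_pos_codegree_le x y z :
  edge3 H x y z -> min_pos_codegree H <= #|nb H x y|.
Proof.
move=> h; rewrite -codegree_nb ?(edge3_neq h) //.
apply/bigmax_leqP => k /forallP/(_ [set x; y])/implyP; apply.
rewrite cards2 (edge3_neq h) /=; apply/exists_inP; exists [set x; y; z] => //.
exact: subsetUl.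
Qed.

Lemma min_pos_codegree_ge k x y z : edge3 H x y z ->
  (forall x y z, edge3 H x y z -> k <= #|nb H x y|) ->
  k <= min_pos_codegree H.
Proof.
move=> h deg.
(* The maximum ranges over an ordinal type; the given edge bounds [k] by a co-degree, hence by the
   number of edges. *)
have kH : k < #|edges H|.+1.
  rewrite ltnS; apply: leq_trans (deg _ _ _ h) _.
  rewrite -codegree_nb ?(edge3_neq h) // /codegree.
  by apply: subset_leq_card; apply/subsetP => e; rewrite inE => /andP[].
pose P (k : 'I_#|edges H|.+1) := [forall S : {set V},
  (#|S| == 2) && [exists e in edges H, S \subset e] ==> (k <= codegree H S)].
apply: (leq_bigmax_cond (P := P) (F := fun k => nat_of_ord k) (Ordinal kH)).
apply/forallP => S; apply/implyP => /andP[/cards2P[a [b [ab ->]]]].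
move=> /exists_inP[e eH /subsetP sub]; rewrite codegree_nb //=.
have ae : a \in e by apply: sub; rewrite !inE eqxx.
have be : b \in e by apply: sub; rewrite !inE eqxx orbT.
have : #|e :\ a :\ b| = 1.
  have := edge_card3 eH; rewrite (cardsD1 a) ae (cardsD1 b) !inE eq_sym ab be.
  by case.
move=> /eqP/cards1P[c ec]; apply: (deg _ _ c).
by rewrite /edge3 -setUA -ec !setD1K // !inE eq_sym ab.
Qed.

Lemma min_pos_codegree_gt0 :
  0 < min_pos_codegree H -> exists x y z, edge3 H x y z.
Proof.
have [H0|[e eH] _] := set_0Vmem (edges H).
  rewrite /min_pos_codegree ltnNge => /negP[]; apply/bigmax_leqP => k _.
  by rewrite -ltnS; apply: leq_trans (ltn_ord k) _; rewrite ltnS H0 cards0.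
by have [x [y [z [_ h]]]] := edge_triple eH; exists x, y, z.
Qed.

End ThreeGraphs.

(** * Concrete edge lists and freeness from $K_4^-$ *)

Definition triple_in (n : nat) (l : seq (seq nat)) (x y z : nat) : bool :=
  has (fun s => all (fun v => (v.+1 \in s) == (v \in [:: x; y; z])) (iota 0 n))
    l.

(** This turns membership in a set of sets into a test on numbers that evaluates, so finite checks
    can be done by computation. *)
Lemma labelled_edges_triple n l (x y z : 'I_n) :
  ([set x; y; z] \in labelled_edges n l) = triple_in n l x y z.
Proof.
rewrite inE; apply/mapP/hasP => -[s sl].
  move=> exyz; exists s => //; apply/allP => v; rewrite mem_iota => /= vn.
  move/setP/(_ (Ordinal vn)): exyz; rewrite !inE -!val_eqE /= -orbA => ->.
  exact: eqxx.
move=> /allP als; exists s => //; apply/setP => v.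
have /als/eqP : nat_of_ord v \in iota 0 n by rewrite mem_iota /=.
by rewrite !inE -!val_eqE /= -orbA => ->.
Qed.

(** Distinctness of the four vertices need not be demanded: any two of them lie in one of the three
    edges, whose vertices are distinct. The apex is [x]. *)
Lemma K4minus_freeP (V : finType) (H : hypergraph 3 V) :
  reflect
    (forall x y z w, edge3 H x y z -> edge3 H x y w -> edge3 H x z w -> False)
    (hfree K4minus H).
Proof.
pose o k : 'I_4 := inord k.
have l123 : labelled_edge 4 [:: 1; 2; 3] = [set o 0; o 1; o 2].
  by apply/setP => -[[|[|[|[|]]]] iv]//; rewrite !inE -!val_eqE /o /= !inordK.
have l124 : labelled_edge 4 [:: 1; 2; 4] = [set o 0; o 1; o 3].
  by apply/setP => -[[|[|[|[|]]]] iv]//; rewrite !inE -!val_eqE /o /= !inordK.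
have l134 : labelled_edge 4 [:: 1; 3; 4] = [set o 0; o 2; o 3].
  by apply/setP => -[[|[|[|[|]]]] iv]//; rewrite !inE -!val_eqE /o /= !inordK.
apply: (iffP idP) => [/existsPn free x y z w hxyz hxyw hxzw|free].
  pose f := [ffun i : 'I_4 => nth x [:: x; y; z; w] i].
  have fo k : k < 4 -> f (o k) = nth x [:: x; y; z; w] k.
    by move=> k4; rewrite ffunE inordK.
  apply/negP: (free f); rewrite negbK; apply/andP; split.
    apply/injectiveP => i j; rewrite !ffunE => /eqP; rewrite nth_uniq //.
      by move/eqP/val_inj.
    move: (edge3_uniq hxyz) (edge3_uniq hxyw) (edge3_uniq hxzw) => /=.
    rewrite !inE !negb_or.
    by move=> /and3P[/andP[-> ->] -> _] /and3P[/andP[_ ->] -> _] /and3P[_ -> _].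
  apply/subsetP => e /imsetP[e' + ->]; rewrite !inE => /or3P[] /eqP ->.
  - by rewrite l123 !imsetU !imset_set1 !fo.
  - by rewrite l124 !imsetU !imset_set1 !fo.
  - by rewrite l134 !imsetU !imset_set1 !fo.
apply/existsPn => f; apply/negP => /andP[_ /subsetP sub].
apply: (free (f (o 0)) (f (o 1)) (f (o 2)) (f (o 3))).
- apply: sub; apply/imsetP; exists (labelled_edge 4 [:: 1; 2; 3]).
    by rewrite !inE eqxx.
  by rewrite l123 !imsetU !imset_set1.
- apply: sub; apply/imsetP; exists (labelled_edge 4 [:: 1; 2; 4]).
    by rewrite !inE eqxx orbT.
  by rewrite l124 !imsetU !imset_set1.
- apply: sub; apply/imsetP; exists (labelled_edge 4 [:: 1; 3; 4]).
    by rewrite !inE eqxx !orbT.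
  by rewrite l134 !imsetU !imset_set1.
Qed.

(** * Blow-ups as pullbacks along a map *)

(** One notion serves for blow-ups, for isomorphisms (when [c] is bijective) and for placing $H_6$
    inside a larger 3-graph, non-edges included. *)
Definition patterned (W V : finType) (F : hypergraph 3 W) (c : V -> W)
    (H : hypergraph 3 V) : Prop :=
  forall x y z, edge3 H x y z = edge3 F (c x) (c y) (c z).

(** Edges of [F] have three elements, so the size condition forces [c] to be injective on [e]. *)
Definition blowup_edges (W V : finType) (F : hypergraph 3 W) (c : V -> W) :
    {set {set V}} :=
  [set e : {set V} | (#|e| == 3) && (c @: e \in edges F)].

Lemma blowup_uniform (W V : finType) (F : hypergraph 3 W) (c : V -> W) :
  [forall e in blowup_edges F c, #|e| == 3].
Proof. by apply/forall_inP => e; rewrite inE => /andP[]. Qed.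

Definition blowup (W V : finType) (F : hypergraph 3 W) (c : V -> W) :
  hypergraph 3 V := Hypergraph (blowup_uniform F c).

Section Patterned.

Variables (W V : finType) (F : hypergraph 3 W) (c : V -> W).

Lemma imset_triple (x y z : V) : c @: [set x; y; z] = [set c x; c y; c z].
Proof. by rewrite !imsetU !imset_set1. Qed.

Lemma patterned_uniq x y z : edge3 F (c x) (c y) (c z) -> uniq [:: x; y; z].
Proof.
by move=> /edge3_uniq u; apply: (@map_uniq _ _ c).
Qed.

Lemma blowup_patterned : patterned F c (blowup F c).
Proof.
move=> x y z; rewrite /edge3 inE imset_triple.
apply/andb_idl => /patterned_uniq/card_uniqP /= <-.
by apply/eqP/eq_card => v; rewrite !inE orbA.
Qed.

Variables (H : hypergraph 3 V).

Lemma patterned_section x y z : edge3 F (c x) (c y) (c z) ->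
  exists2 v : W -> V, forall i, i \in [set c x; c y; c z] -> v i \in vclass c i
    & [set x; y; z] = v @: [set c x; c y; c z].
Proof.
move=> /edge3_uniq; rewrite /= !inE negb_or => /and3P[/andP[xy xz] yz _].
exists (fun i => if i == c x then x else if i == c y then y else z) => [i|].
  rewrite !inE -orbA => /or3P[] /eqP->.
  - by rewrite !eqxx.
  - by rewrite [c y == c x]eq_sym (negPf xy) !eqxx.
  - by rewrite ![c z == _]eq_sym (negPf xz) (negPf yz) !eqxx.
rewrite !imsetU !imset_set1 !eqxx ![c z == _]eq_sym.
by rewrite [c y == c x]eq_sym (negPf xy) (negPf xz) (negPf yz).
Qed.

Lemma blowup_along_patterned : blowup_along F c H <-> patterned F c H.
Proof.
split=> [HF x y z|HF e].
  apply/idP/idP => [h|h].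
    have [f [v [fF vc exyz]]] := (HF _).1 h.
    have cv i : i \in f -> c (v i) = i by move/vc; rewrite inE => /eqP.
    rewrite /edge3 -imset_triple exyz -imset_comp.
    by rewrite (eq_in_imset (g := id)) ?imset_id.
  have [v vc vE] := patterned_section h.
  by apply/(HF _).2; exists [set c x; c y; c z], v.
split=> [/edge_triple[x [y [z [-> h]]]]|[f [v [fF vc ->]]]].
  rewrite HF in h; have [v vc vE] := patterned_section h.
  by exists [set c x; c y; c z], v.
have [i [j [l [fE h]]]] := edge_triple fF; subst f.
have cv i' : i' \in [set i; j; l] -> c (v i') = i'.
  by move/vc; rewrite inE => /eqP.
rewrite !imsetU !imset_set1 -/(edge3 H _ _ _) HF !cv // !inE eqxx ?orbT //.
Qed.

Hypothesis HF : patterned F c H.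

Lemma patterned_free : hfree K4minus F -> hfree K4minus H.
Proof.
move=> /K4minus_freeP free; apply/K4minus_freeP => x y z w.
by rewrite !HF; apply: free.
Qed.

(** Whether [w] is joined to [x] and [y] depends only on [c w], so the neighbourhood is a union of
    classes. *)
Lemma card_nb_patterned x y :
  #|nb H x y| = \sum_(i in nb F (c x) (c y)) #|vclass c i|.
Proof.
rewrite -sum1_card (partition_big c (mem (nb F (c x) (c y)))) /=; last first.
  by move=> w; rewrite !inE HF.
apply: eq_bigr => i; rewrite inE => iF; rewrite -sum1_card; apply: eq_bigl => w.
by rewrite !inE HF; apply: andb_idl => /eqP->.
Qed.

End Patterned.

Lemma isomorphic_edge3 (V W : finType) (G : hypergraph 3 V)
    (H : hypergraph 3 W) : isomorphic G H <->
  exists2 f : V -> W, bijective f & patterned H f G.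
Proof.
split=> -[f fb fE]; exists f => //.
  move=> x y z; rewrite /edge3 -fE -imset_triple mem_imset //.
  exact: imset_inj (bij_inj fb).
have [g fK gK] := fb.
apply/setP => e; apply/imsetP/idP => [[e' e'G ->]|].
  have [x [y [z [-> h]]]] := edge_triple e'G.
  by rewrite imset_triple -/(edge3 H _ _ _) -fE.
move=> /edge_triple[x [y [z [-> h]]]]; exists [set g x; g y; g z].
  by rewrite -/(edge3 G _ _ _) fE !gK.
by rewrite imset_triple !gK.
Qed.

(** In each class, [f] sends the element at a given position of the enumeration for [c] to the one
    at the same position for [c']. *)
Lemma relabel (V I : finType) (c c' : V -> I) :
  (forall i, #|vclass c i| = #|vclass c' i|) ->
  exists2 f : V -> V, bijective f & forall x, c' (f x) = c x.
Proof.
move=> card.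
pose f x := nth x (enum (vclass c' (c x))) (index x (enum (vclass c (c x)))).
have xlt x : index x (enum (vclass c (c x))) < size (enum (vclass c' (c x))).
  by rewrite -cardE -card cardE index_mem mem_enum inE.
have cf x : c' (f x) = c x.
  by have := mem_nth x (xlt x); rewrite mem_enum inE => /eqP.
exists f => //; apply: injF_bij => x y fxy.
have cxy : c x = c y by rewrite -!cf fxy.
move: fxy; rewrite /f -cxy; move: (xlt x) (xlt y); rewrite -cxy => ix iy.
rewrite (set_nth_default x y iy) => /eqP; rewrite nth_uniq ?enum_uniq //.
move/eqP => exy; have xin : x \in enum (vclass c (c x)) by rewrite mem_enum inE.
have yin : y \in enum (vclass c (c x)) by rewrite mem_enum inE cxy.
by rewrite -(nth_index x xin) exy nth_index.
Qed.

Lemma patterned_isomorphic (V W : finType) (F : hypergraph 3 W)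
    (c c' : V -> W) (G H : hypergraph 3 V) :
  patterned F c G -> patterned F c' H ->
  (forall i, #|vclass c i| = #|vclass c' i|) -> isomorphic G H.
Proof.
move=> GF HF /relabel[f fb cf]; apply/isomorphic_edge3; exists f => //.
by move=> x y z; rewrite GF HF !cf.
Qed.

(** * The two patterns: a single edge and $H_6$ *)

Definition K3 : hypergraph 3 'I_3 :=
  Hypergraph (@labelled_edges_uniform 3 3 [:: [:: 1; 2; 3]] isT).

Lemma edge3_K3 (i j l : 'I_3) : edge3 K3 i j l = uniq [:: i; j; l].
Proof.
rewrite /edge3 labelled_edges_triple /= !inE -!val_eqE /=.
by move: i j l => -[[|[|[|?]]] ?] [[|[|[|?]]] ?] [[|[|[|?]]] ?].
Qed.

(* Vertices are numbered 0, ..., 5 here, as in 'I_6, but 1, ..., 6 in the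
   list. *)
Definition h6 : nat -> nat -> nat -> bool :=
  triple_in 6
    [:: [:: 1; 2; 3]; [:: 1; 2; 4]; [:: 3; 4; 5]; [:: 3; 4; 6]; [:: 5; 6; 1];
        [:: 5; 6; 2]; [:: 1; 3; 5]; [:: 1; 4; 6]; [:: 2; 3; 6]; [:: 2; 4; 5]].

Lemma edge3_H6 (i j l : 'I_6) : edge3 H6 i j l = h6 i j l.
Proof. exact: labelled_edges_triple. Qed.

Lemma K3_free : hfree K4minus K3.
Proof.
apply/K4minus_freeP => x y z w; rewrite !edge3_K3 /= !inE -!val_eqE /=.
by move: x y z w => -[[|[|[|?]]] ?] [[|[|[|?]]] ?] [[|[|[|?]]] ?]
  [[|[|[|?]]] ?].
Qed.

(** The rule on four vertices: the booleans tell which of their four triples are edges. *)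
Definition even_pair (a b c d : bool) : bool := a + b + c + d \in [:: 0; 2].

(** Both 0 and 2 are even, so by parity three of the triples determine the fourth. *)
Lemma even_pair_xor a b c d : even_pair a b c d -> a = b (+) c (+) d.
Proof. by case: a b c d => [] [] [] []. Qed.

Lemma all_iotaP n (P : pred nat) :
  all P (iota 0 n) -> forall i, i < n -> P i.
Proof. by move=> /allP Pn i ltin; apply: Pn; rewrite mem_iota. Qed.

Lemma h6_even_pair i j l m : i < 6 -> j < 6 -> l < 6 -> m < 6 ->
  even_pair (h6 i j l) (h6 i j m) (h6 i l m) (h6 j l m).
Proof.
move=> i6 j6 l6 m6.
have ok : all (fun i => all (fun j => all (fun l => all (fun m =>
  even_pair (h6 i j l) (h6 i j m) (h6 i l m) (h6 j l m))
    (iota 0 6)) (iota 0 6)) (iota 0 6)) (iota 0 6) by vm_compute.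
move/all_iotaP/(_ i i6)/all_iotaP/(_ j j6): ok => ok.
by move/all_iotaP/(_ l l6)/all_iotaP/(_ m m6): ok.
Qed.

Lemma H6_free : hfree K4minus H6.
Proof.
apply/K4minus_freeP => x y z w; rewrite !edge3_H6 => hxyz hxyw hxzw.
have := @h6_even_pair x y z w; rewrite hxyz hxyw hxzw => /(_ _ _ _ _).
by case: (h6 y z w) => /(_ (ltn_ord x) (ltn_ord y) (ltn_ord z) (ltn_ord w)).
Qed.

Lemma sum_nb_H6 (s : 'I_6 -> nat) (i j : 'I_6) :
  \sum_(l in nb H6 i j) s l = \sum_(l < 6) h6 i j l * s l.
Proof.
rewrite big_mkcond; apply: eq_bigr => l _; rewrite inE edge3_H6.
by case: h6; rewrite ?mul1n.
Qed.

(** The count is the ceiling of $(n-i)/m$, written without a truncated difference $n-i$. In the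
    induction the quotient grows exactly when the new element [n] has residue [i]. *)
Lemma count_mod n m i : i < m ->
  #|[set x : 'I_n | x %% m == i]| = (n + (m.-1 - i)) %/ m.
Proof.
move=> im; have m_gt0 : 0 < m by apply: leq_trans im.
rewrite -sum1_card.
under eq_bigl do rewrite inE.
rewrite (big_mkcond _ (fun=> 1)) /=; elim: n => [|n IHn].
  by rewrite big_ord0 divn_small //; lia.
rewrite big_ord_recr /= IHn addSn divnS // addnC; congr (_ + _).
have -> : (n + (m.-1 - i)).+1 = n + (m - i) by lia.
have -> : (n %% m == i) = (m %| n + (m - i)) => [|]; last by case: (_ %| _).
rewrite -{1}(modn_small im) -(eqn_modDr (m - i)) subnKC ?modnn //.
exact: ltnW.
Qed.

Lemma tripartite_patterned (V : finType) (H : hypergraph 3 V) (c : V -> 'I_3) :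
  (forall e : {set V}, e \in edges H <-> forall i, #|e :&: vclass c i| = 1) <->
  patterned K3 c H.
Proof.
have tripleE x y z : (forall i, #|[set x; y; z] :&: vclass c i| = 1) <->
    uniq [:: c x; c y; c z].
  split=> [h|].
    (* All three indices occur in a list of length three, so its entries are distinct. *)
    have cover (i : 'I_3) : i \in [:: c x; c y; c z].
      have /eqP/cards1P[u uE] := h i.
      have : u \in [set x; y; z] :&: vclass c i by rewrite uE set11.
      by rewrite !inE -orbA => /andP[/or3P[] /eqP-> /eqP->]; rewrite eqxx ?orbT.
    apply/card_uniqP; rewrite -[RHS](card_ord 3); apply: eq_card => i.
    by rewrite cover.
  rewrite /= !inE negb_or => /and3P[/andP[xy xz] yz _] i.
  have : i \in [:: c x; c y; c z].
    move: (c x) (c y) (c z) xy xz yz i.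
    by move=> [[|[|[|?]]] ?] [[|[|[|?]]] ?] [[|[|[|?]]] ?] // _ _ _
      [[|[|[|?]]] ?].
  rewrite !inE => /or3P[] /eqP->; apply/eqP/cards1P.
  - exists x; apply/setP => u; rewrite !inE.
    apply/idP/eqP => [|->]; last by rewrite !eqxx.
    rewrite -orbA; case/andP => /or3P[] /eqP-> //.
      by rewrite eq_sym (negPf xy).
    by rewrite eq_sym (negPf xz).
  - exists y; apply/setP => u; rewrite !inE.
    apply/idP/eqP => [|->]; last by rewrite !eqxx orbT.
    rewrite -orbA; case/andP => /or3P[] /eqP-> //.
      by rewrite (negPf xy).
    by rewrite eq_sym (negPf yz).
  - exists z; apply/setP => u; rewrite !inE.
    apply/idP/eqP => [|->]; last by rewrite !eqxx orbT.
    rewrite -orbA; case/andP => /or3P[] /eqP-> //.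
      by rewrite (negPf xz).
    by rewrite (negPf yz).
split=> [h x y z|h e].
  by rewrite edge3_K3; apply/idP/idP => [/h/tripleE|/tripleE/h].
split=> [/edge_triple[x [y [z [-> hxyz]]]]|e1].
  by apply/tripleE; rewrite -edge3_K3 -h.
(* A set meeting each of the three classes once has three elements. *)
have [x [y [z exyz]]] : exists x y z, e = [set x; y; z].
  apply: card3_set.
  rewrite -sum1_card (partition_big c xpredT) //=.
  rewrite -[RHS](card_ord 3) -sum1_card; apply: eq_bigr => i _.
  rewrite -[RHS](e1 i) -sum1_card; apply: eq_bigl => x.
  by rewrite !inE.
rewrite exyz -/(edge3 H x y z) h edge3_K3; apply/tripleE; rewrite -exyz.
exact: e1.
Qed.


(** * The upper bound *)

Section K4minusFree.

Variables (V : finType) (H : hypergraph 3 V).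
Hypothesis free : hfree K4minus H.

Lemma nb_disjoint x y z :
  edge3 H x y z -> [disjoint nb H x y & nb H x z].
Proof.
move/K4minus_freeP: free => no h; rewrite disjoints_subset; apply/subsetP => w.
by rewrite !inE => hxyw; apply/negP => hxzw; apply: no h hxyw hxzw.
Qed.

Lemma card_nbU x y z : edge3 H x y z ->
  #|nb H x y :|: nb H x z :|: nb H y z| =
    #|nb H x y| + #|nb H x z| + #|nb H y z|.
Proof.
have nbC a b : nb H a b = nb H b a by apply/setP => w; rewrite !inE edge3_12.
move=> h; have disjU (A B C : {set V}) : [disjoint A & B] ->
    [disjoint A & C] -> [disjoint B & C] ->
    #|A :|: B :|: C| = #|A| + #|B| + #|C|.
  move=> AB AC BC; rewrite !cardsU setIUl.
  by rewrite !disjoint_setI0 // setU0 cards0 !subn0.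
apply: disjU; first exact: nb_disjoint.
  by rewrite nbC; apply: nb_disjoint; rewrite edge3_12.
by rewrite nbC [nb H y z]nbC; apply: nb_disjoint; rewrite edge3_rot.
Qed.

Lemma min_pos_codegree_third : min_pos_codegree H <= #|V| %/ 3.
Proof.
have [->//|/min_pos_codegree_gt0[x [y [z h]]]] := posnP (min_pos_codegree H).
rewrite leq_divRL //.
have := max_card (nb H x y :|: nb H x z :|: nb H y z); rewrite card_nbU //.
have := min_pos_codegree_le h.
have : edge3 H x z y by rewrite edge3_23.
have : edge3 H y z x by rewrite -edge3_rot.
by move=> /min_pos_codegree_le + /min_pos_codegree_le; lia.
Qed.

End K4minusFree.

(** * The extremal constructions *)

Lemma sum_vclass (V I : finType) (c : V -> I) :
  \sum_i #|vclass c i| = #|V|.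
Proof.
rewrite -[RHS]sum1_card (partition_big c xpredT) //=.
by apply: eq_bigr => i _; rewrite -sum1_card; apply: eq_bigl => x; rewrite inE.
Qed.

(** Each of the other two classes exceeds class [i] by at most one, so
    [#|V| <= 3 * #|vclass c i| + 2]. *)
Lemma balanced_vclass (V : finType) (c : V -> 'I_3) :
  (forall i j, #|vclass c i| <= #|vclass c j| + 1) ->
  forall i, #|V| %/ 3 <= #|vclass c i|.
Proof.
move=> bal i; have := sum_vclass c; rewrite (bigD1 i) //=.
set s := \sum_(_ < 3 | _) _ => sE.
have : s <= 2 * (#|vclass c i| + 1).
  have other : #|[pred j : 'I_3 | j != i]| = 2 by rewrite cardC1 card_ord.
  rewrite -[X in X * _]other -sum_nat_const; apply: leq_sum => j _.
  exact: bal.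
lia.
Qed.

Lemma tripartite_codegree n (T : hypergraph 3 'I_n) :
  complete_balanced_tripartite T ->
  hfree K4minus T /\ n %/ 3 <= min_pos_codegree T.
Proof.
move=> [c [bal /tripartite_patterned Tc]].
split; first exact: patterned_free Tc K3_free.
(* For [n < 3] the bound is 0; otherwise every class is non-empty and an edge exists. *)
have [->//|n3] := posnP (n %/ 3).
have classes i : n %/ 3 <= #|vclass c i|.
  by have := balanced_vclass bal i; rewrite card_ord.
have rep i : exists x, c x = i.
  have /card_gt0P[x] : 0 < #|vclass c i| by apply: leq_trans (classes i).
  by rewrite inE => /eqP; exists x.
have [x cx] := rep ord0; have [y cy] := rep (lift ord0 ord0).
have [z cz] := rep ord_max.
apply: (@min_pos_codegree_ge _ _ _ x y z).
  by rewrite Tc cx cy cz edge3_K3.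
move=> x' y' z' h; rewrite (card_nb_patterned Tc) (bigD1 (c z')) /=.
  by apply: leq_trans (classes (c z')) (leq_addr _ _).
by rewrite inE -Tc.
Qed.

Lemma tripartite_exists n :
  exists T : hypergraph 3 'I_n, complete_balanced_tripartite T.
Proof.
pose c (x : 'I_n) : 'I_3 := inord (x %% 3).
have cE i : #|vclass c i| = (n + (2 - i)) %/ 3.
  rewrite -(@count_mod n 3) //; apply: eq_card => x; rewrite !inE -val_eqE /=.
  by rewrite inordK // ltn_mod.
exists (blowup K3 c), c; split.
  by move=> i j; rewrite !cE; lia.
exact/tripartite_patterned/blowup_patterned.
Qed.

Lemma equal_blowup_exists n : n %% 6 = 0 ->
  exists B : hypergraph 3 'I_n, equal_blowup H6 B.
Proof.
move=> n6; pose c (x : 'I_n) : 'I_6 := inord (x %% 6).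
have cE i : #|vclass c i| = (n + (5 - i)) %/ 6.
  rewrite -(@count_mod n 6) //; apply: eq_card => x; rewrite !inE -val_eqE /=.
  by rewrite inordK // ltn_mod.
exists (blowup H6 c), c; split.
  by move=> i j; rewrite !cE; move: (ltn_ord i) (ltn_ord j); lia.
exact/blowup_along_patterned/blowup_patterned.
Qed.

Lemma coex_K4minus n : coex n K4minus = n %/ 3.
Proof.
apply/eqP; rewrite eqn_leq; apply/andP; split.
  apply/bigmax_leqP => H free.
  by have := min_pos_codegree_third free; rewrite card_ord.
have [T /tripartite_codegree[free le]] := tripartite_exists n.
exact: leq_trans le (leq_bigmax_cond _ free).
Qed.

Lemma tripartite_extremal n (T : hypergraph 3 'I_n) :
  complete_balanced_tripartite T -> extremal K4minus T.
Proof.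
move=> /tripartite_codegree[free le]; split=> //; rewrite coex_K4minus.
apply/eqP; rewrite eqn_leq le andbT.
by have := min_pos_codegree_third free; rewrite card_ord.
Qed.

Lemma card_vclass_equal (V I : finType) (c : V -> I) q :
  (forall i j : I, #|vclass c i| = #|vclass c j|) -> #|V| = q * #|I| ->
  forall i, #|vclass c i| = q.
Proof.
move=> eqc VE i; have := sum_vclass c; rewrite VE.
under eq_bigr do rewrite (eqc _ i).
have I0 : 0 < #|I| by apply/card_gt0P; exists i.
by rewrite sum_nat_const mulnC => /eqP; rewrite eqn_pmul2r // => /eqP.
Qed.

(** $H_6$ is a 2-(6,3,2) design; in a blow-up with classes of size $n/6$ every positive co-degree is
    therefore $2\cdot n/6=n/3$. *)
Lemma h6_pair i j : i < 6 -> j < 6 -> i != j -> \sum_(l < 6) h6 i j l = 2.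
Proof.
move=> i6 j6 ij; rewrite !big_ord_recl big_ord0.
by move: i j i6 j6 ij => -[|[|[|[|[|[|?]]]]]] [|[|[|[|[|[|?]]]]]].
Qed.

Lemma equal_blowup_extremal n (B : hypergraph 3 'I_n) :
  0 < n -> n %% 6 = 0 -> equal_blowup H6 B -> extremal K4minus B.
Proof.
move=> n_gt0 n6 [c [eqc /blowup_along_patterned Bc]].
have free := patterned_free Bc H6_free.
split=> //; rewrite coex_K4minus; apply/eqP; rewrite eqn_leq.
have := min_pos_codegree_third free; rewrite card_ord => -> /=.
have cE : forall i, #|vclass c i| = n %/ 6.
  by apply: card_vclass_equal => //; rewrite !card_ord; lia.
have rep i : exists x, c x = i.
  have /card_gt0P[x] : 0 < #|vclass c i| by rewrite cE; lia.
  by rewrite inE => /eqP; exists x.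
have [x cx] := rep (inord 0); have [y cy] := rep (inord 1).
have [z cz] := rep (inord 2).
apply: (@min_pos_codegree_ge _ _ _ x y z).
  by rewrite Bc cx cy cz edge3_H6 !inordK.
move=> x' y' z' h; rewrite (card_nb_patterned Bc) sum_nb_H6.
under eq_bigr do rewrite cE.
rewrite -big_distrl /= h6_pair //; first by lia.
by move: h; rewrite Bc => /edge3_neq.
Qed.

(** In a complete tripartite 3-graph, the edges 123 and 135 put 2 and 5 in one class, and 135 and
    156 put 3 and 6 in one class. Then 126 would be an edge like 135, but it is not an edge of
    $H_6$. *)
Lemma tripartite_not_equal_blowup n (T B : hypergraph 3 'I_n) :
  0 < n -> n %% 6 = 0 -> complete_balanced_tripartite T -> equal_blowup H6 B ->
  ~ isomorphic T B.
Proof.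
move=> n_gt0 n6 [t [_ /tripartite_patterned Tt]].
move=> [b [eqb /blowup_along_patterned Bb]] /isomorphic_edge3[f [g fK gK] Tf].
have bE : forall i, #|vclass b i| = n %/ 6.
  by apply: card_vclass_equal => //; rewrite !card_ord; lia.
have rep i : i < 6 -> exists x, b (f x) = i :> nat.
  move=> i6.
  have /card_gt0P[x] : 0 < #|vclass b (Ordinal i6)| by rewrite bE; lia.
  by rewrite inE => /eqP bx; exists (g x); rewrite gK bx.
(* The names [p1], ..., [p6] follow the labels of $H_6$, one more than the ordinals. *)
have [p1 b1] := rep 0 isT; have [p2 b2] := rep 1 isT.
have [p3 b3] := rep 2 isT; have [p5 b5] := rep 4 isT.
have [p6 b6] := rep 5 isT.
have TE x y z : edge3 T x y z = h6 (b (f x)) (b (f y)) (b (f z)).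
  by rewrite Tf Bb edge3_H6.
have h135 : edge3 T p1 p3 p5 by rewrite TE b1 b3 b5.
have h123 : edge3 T p1 p2 p3 by rewrite TE b1 b2 b3.
have h156 : edge3 T p1 p5 p6 by rewrite TE b1 b5 b6.
have : edge3 T p1 p2 p6 = false by rewrite TE b1 b2 b6.
move: h135 h123 h156; rewrite !Tt !edge3_K3 /= !inE -!val_eqE /=.
by move: (t p1) (t p2) (t p3) (t p5) (t p6) =>
  -[[|[|[|?]]] ?] [[|[|[|?]]] ?] [[|[|[|?]]] ?] [[|[|[|?]]] ?] [[|[|[|?]]] ?].
Qed.

(** * Rigidity of $H_6$ under the rule on four vertices *)

(** Here [f m] stands for the triple formed by twins of [i] and [j] with vertex [m] of the copy. By
    parity [f] agrees with [h6 i j] everywhere or nowhere, and a finite check excludes the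
    complement. *)
Lemma h6_pair_law (f : nat -> bool) i j : i < 6 -> j < 6 ->
  (forall m s, m < 6 -> s < 6 ->
     even_pair (f m) (f s) (h6 i m s) (h6 j m s)) ->
  forall m, m < 6 -> f m = h6 i j m.
Proof.
move=> i6 j6 law m m6; apply/eqP/negPn/negP => fm.
have fC s : s < 6 -> f s = ~~ h6 i j s.
  move=> s6; move: fm (even_pair_xor (law m s m6 s6)).
  move: (even_pair_xor (h6_even_pair i6 j6 m6 s6)).
  move: (h6 i j m) (f m) (f s) (h6 i j s) (h6 i m s) (h6 j m s).
  by do 6!case.
have ok : all (fun i => all (fun j => has (fun m => has (fun s =>
  ~~ even_pair (~~ h6 i j m) (~~ h6 i j s) (h6 i m s) (h6 j m s))
    (iota 0 6)) (iota 0 6)) (iota 0 6)) (iota 0 6) by vm_compute.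
move/all_iotaP/(_ i i6)/all_iotaP/(_ j j6)/hasP: ok => -[u + /hasP[s]].
by rewrite !mem_iota => /= u6 s6; rewrite -!fC // law.
Qed.

(* The pairs in {0, ..., 5} and the edges of H_6 are the edges and the vertices
   of the Petersen graph; g is one of its six perfect matchings, and these are
   the six links of H_6. *)
Lemma h6_twin (g : nat -> nat -> bool) :
  (forall j l m, j < l -> l < m -> m < 6 -> h6 j l m ->
     g j l + g j m + g l m = 1) ->
  exists2 i, i < 6 & forall j l, j < l -> l < 6 -> g j l = h6 i j l.
Proof.
move=> law.
pose prs := [:: (0, 1); (0, 2); (0, 3); (0, 4); (0, 5); (1, 2); (1, 3);
  (1, 4); (1, 5); (2, 3); (2, 4); (2, 5); (3, 4); (3, 5); (4, 5)].
suff /mapP[i + gE] : [seq g q.1 q.2 | q <- prs] \in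
    [seq [seq h6 i q.1 q.2 | q <- prs] | i <- iota 0 6].
  rewrite mem_iota => i6; exists i => // j l jl l6.
  have /eq_in_map gE' := gE; apply: (gE' (j, l)).
  by move: j l jl l6 {gE gE'} => [|[|[|[|[|[|?]]]]]] [|[|[|[|[|[|?]]]]]].
(* The laws of the ten edges come in the order in which the case analysis decides their pairs, so
   that each prunes the branches at once. *)
move: (law 1 2 5 isT isT isT isT) (law 1 4 5 isT isT isT isT)
  (law 1 3 4 isT isT isT isT) (law 0 1 2 isT isT isT isT)
  (law 0 1 3 isT isT isT isT) (law 0 2 4 isT isT isT isT)
  (law 0 4 5 isT isT isT isT) (law 0 3 5 isT isT isT isT)
  (law 2 3 4 isT isT isT isT) (law 2 3 5 isT isT isT isT).
clear law; set pats := (X in _ \in X).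
have -> : [seq g q.1 q.2 | q <- prs] =
  [:: g 0 1; g 0 2; g 0 3; g 0 4; g 0 5; g 1 2; g 1 3; g 1 4; g 1 5; g 2 3;
      g 2 4; g 2 5; g 3 4; g 3 5; g 4 5] by [].
move: (g 0 1) (g 0 2) (g 0 3) (g 0 4) (g 0 5) (g 1 2) (g 1 3) (g 1 4) (g 1 5)
  (g 2 3) (g 2 4) (g 2 5) (g 3 4) (g 3 5) (g 4 5) => a01 a02 a03 a04 a05 a12
  a13 a14 a15 a23 a24 a25 a34 a35 a45.
case: a12; case: a15; case: a25 => // _; case: a14; case: a45 => // _.
all: case: a13; case: a34 => // _; case: a01; case: a02 => // _.
all: case: a03 => // _; case: a04; case: a24 => // _; case: a05 => // _.
all: by case: a35 => // _; case: a23 => // *; vm_compute.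
Qed.

(** Both sides are symmetric and false on repeated arguments. For $H_6$ this leaves twenty
    triples. *)
Lemma patterned_lt n (F : hypergraph 3 'I_n) (V : finType)
    (H : hypergraph 3 V) (p : 'I_n -> V) :
  (forall i j l : 'I_n, i < j -> j < l ->
     edge3 F i j l = edge3 H (p i) (p j) (p l)) ->
  patterned H p F.
Proof.
move=> lt x y z.
wlog xy : x y / x <= y.
  move=> le; have [/le//|/ltnW/le] := leqP x y.
  by rewrite edge3_12 (edge3_12 H).
case: ltngtP xy => // [xy|/val_inj->] _; last by rewrite !edge3_xxz.
have [yz|zy|/val_inj->] := ltngtP y z; last by rewrite !edge3_xyy.
  exact: lt.
rewrite edge3_23 (edge3_23 H).
have [xz|zx|/val_inj->] := ltngtP x z; last by rewrite !edge3_xxz.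
  exact: lt.
by rewrite edge3_12 (edge3_12 H); apply: lt.
Qed.

Ltac edge_perm := first [ by [] | by rewrite edge3_12 | by rewrite edge3_23
  | by rewrite edge3_13 | by rewrite edge3_rot | by rewrite -edge3_rot ].

(** * Structure of the 3-graphs attaining the bound *)

Section Classification.

Variables (V : finType) (H : hypergraph 3 V) (k : nat).
Hypothesis free : hfree K4minus H.
Hypothesis deg : forall x y z, edge3 H x y z -> k <= #|nb H x y|.
Hypothesis cardV : #|V| = 3 * k.

Local Notation h := (edge3 H).

(** Three disjoint neighbourhoods of size at least [k] must fit into [3 * k] vertices. *)
Lemma card_nb_tight x y z : h x y z -> #|nb H x y| = k.
Proof.
move=> hxyz; have := max_card (nb H x y :|: nb H x z :|: nb H y z).
rewrite (card_nbU free hxyz) cardV; have := deg hxyz.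
have : h x z y by rewrite edge3_23.
have : h y z x by rewrite -edge3_rot.
by move=> /deg + /deg; lia.
Qed.

Lemma nb_cover x y z w : h x y z -> [|| h x y w, h x z w | h y z w].
Proof.
move=> hxyz; suff /setP/(_ w) : nb H x y :|: nb H x z :|: nb H y z = setT.
  by rewrite !inE orbA.
have hxzy : h x z y by rewrite edge3_23.
have hyzx : h y z x by rewrite -edge3_rot.
apply/eqP; rewrite eqEcard subsetT cardsT cardV (card_nbU free hxyz).
by rewrite (card_nb_tight hxyz) (card_nb_tight hxzy) (card_nb_tight hyzx); lia.
Qed.

Lemma no_K4minus x y z w : h x y z -> h x y w -> h x z w -> False.
Proof. exact: (K4minus_freeP _ free). Qed.

Lemma exactly_one x y z w : h x y z -> h x y w + h x z w + h y z w = 1.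
Proof.
move=> hxyz; have := nb_cover w hxyz.
have hyxz : h y x z by rewrite edge3_12.
have hzxy : h z x y by rewrite edge3_rot.
have := @no_K4minus x y z w hxyz; have := @no_K4minus y x z w hyxz.
have := @no_K4minus z x y w hzxy.
rewrite (edge3_12 H y x) (edge3_12 H z x) (edge3_12 H z y).
case: (h x y w); case: (h x z w); case: (h y z w) => //.
- by move=> _ _ /(_ isT isT).
- by move=> _ _ /(_ isT isT).
- by move=> _ /(_ isT isT).
- by move=> /(_ isT isT).
Qed.

(** If one of the four triples is an edge, [exactly_one] applied to it gives exactly one further
    edge. *)
Lemma even_triples x y z w :
  even_pair (h x y z) (h x y w) (h x z w) (h y z w).
Proof.
have := @exactly_one x y z w.
have : h x y w -> h x y z + h x z w + h y z w = 1.
  by move/(exactly_one z); rewrite (edge3_23 H x w) (edge3_23 H y w).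
have : h x z w -> h x y z + h x y w + h y z w = 1.
  move/(exactly_one y).
  by rewrite (edge3_23 H x z) (edge3_23 H x w) -(edge3_rot H y z w).
have : h y z w -> h x y z + h x y w + h x z w = 1.
  by move/(exactly_one x); rewrite -!(edge3_rot H x).
case: (h x y z); case: (h x y w); case: (h x z w); case: (h y z w) => //.
all: try by move=> /(_ isT).
all: try by move=> _ /(_ isT).
all: try by move=> _ _ /(_ isT).
all: by move=> _ _ _ /(_ isT).
Qed.

(** In the link of [z] the hypotheses give a path [a], [y], [x], [b] with non-adjacent ends. The
    vertex [c] found below closes it to a five-cycle, which is the link of a vertex of $H_6$. *)
Lemma h6_embedding x y z a b :
  h x y z -> h a y z -> h b x z -> ~~ h a b z ->
  exists p : 'I_6 -> V, patterned H p H6.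
Proof.
move=> hxyz hayz hbxz hNabz.
have hxzb : h x z b by edge_perm.
have hazy : h a z y by edge_perm.
(* Inclusion of neighbourhoods of equal size [k] would be equality, but [b] lies only in that of
   [xz]. *)
have /subsetPn[c] : ~~ (nb H a z \subset nb H x z).
  apply: contra hNabz => sub; have nbE : nb H a z = nb H x z.
    apply/eqP; rewrite eqEcard sub (card_nb_tight hazy).
    by rewrite (card_nb_tight hxzb) leqnn.
  have : b \in nb H a z by rewrite nbE inE.
  by rewrite inE; edge_perm.
rewrite !inE => hazc hNxzc.
(* The vertices 1, ..., 6 of H_6 are z, b, x, c, y, a. *)
have e135 : h z x y by edge_perm.
have e156 : h z y a by edge_perm.
have e123 : h z b x by edge_perm.
have e126 : h z b a = false by move/negbTE: hNabz => ?; edge_perm.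
have e146 : h z c a by edge_perm.
have e134 : h z x c = false by move/negbTE: hNxzc => ?; edge_perm.
have e145 : h z c y = false.
  apply/negP => hzcy; apply: (@no_K4minus z y a c e156); edge_perm.
(* From here, an edge is found by covering, or two known edges on four vertices exclude the other
   two triples, or three known triples fix the fourth. *)
have e345 : h x c y.
  have := nb_cover c e135.
  by rewrite e134 (edge3_23 H z) e145 (edge3_23 H x).
have [e125 e235] : h z b y = false /\ h b x y = false.
  by move: (even_triples z b x y); rewrite e123 e135; do 2!case: (h _ _ _).
have e256 : h b y a.
  by move: (even_triples z b y a); rewrite e125 e126 e156; case: (h b y a).
have [e136 e356] : h z x a = false /\ h x y a = false.
  by move: (even_triples z x y a); rewrite e135 e156; do 2!case: (h _ _ _).
have e236 : h b x a.
  by move: (even_triples z b x a); rewrite e123 e126 e136; case: (h b x a).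
have e346 : h x c a.
  by move: (even_triples z x c a); rewrite e134 e136 e146; case: (h x c a).
have e456 : h c y a = false.
  by move: (even_triples z c y a); rewrite e145 e146 e156; case: (h c y a).
have [e234 e246] : h b x c = false /\ h b c a = false.
  by move: (even_triples b x c a); rewrite e236 e346; do 2!case: (h _ _ _).
have e124 : h z b c.
  by move: (even_triples z b x c); rewrite e123 e134 e234; case: (h z b c).
have e245 : h b c y.
  by move: (even_triples b x c y); rewrite e234 e235 e345; case: (h b c y).
exists (fun i => nth z [:: z; b; x; c; y; a] i).
apply: patterned_lt => i j l; rewrite edge3_H6.
move: i j l => -[[|[|[|[|[|[|?]]]]]] ?] [[|[|[|[|[|[|?]]]]]] ?] //
  [[|[|[|[|[|[|?]]]]]] ?] //= _ _; apply/esym.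
all: assumption.
Qed.

Lemma h6_classes (p : 'I_6 -> V) : patterned H p H6 ->
  exists2 c : V -> 'I_6, patterned H6 c H &
    forall i, #|vclass c i| * 2 = k.
Proof.
move=> pH6; have pE i j l : h (p i) (p j) (p l) = h6 i j l.
  by rewrite -edge3_H6 pH6.
have twin x : exists i : 'I_6, forall j l, h x (p j) (p l) = h6 i j l.
  pose g j l := h x (p (inord j)) (p (inord l)).
  have [j l m jl lm m6 hjlm|i i6 gE] := @h6_twin g.
    have l6 := ltn_trans lm m6; have j6 := ltn_trans jl l6.
    have := @exactly_one (p (inord j)) (p (inord l)) (p (inord m)) x.
    rewrite pE !inordK // => /(_ hjlm).
    by rewrite -!(edge3_rot H x).
  have gE' (j l : 'I_6) : j < l -> h x (p j) (p l) = h6 i j l.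
    by move=> jl; rewrite -gE // /g !inord_val.
  exists (Ordinal i6) => j l; rewrite -(edge3_H6 (Ordinal i6)).
  have [jl|lj|/val_inj ->] := ltngtP j l.
  - by rewrite gE' // edge3_H6.
  - by rewrite edge3_23 gE' // edge3_23 edge3_H6.
  - by rewrite !edge3_xyy.
have [c cE] := fin_all_exists twin.
(* So far [c] is controlled against two vertices of the copy; this step replaces one of them by an
   arbitrary vertex, and [cH] replaces the other through the four vertices [x], [y], [z],
   [p ord0]. *)
have c2 x y m : h x y (p m) = h6 (c x) (c y) m.
  pose f m := h x y (p (inord m)).
  rewrite -[RHS](@h6_pair_law f) ?ltn_ord // /f ?inord_val // => s t s6 t6.
  have := even_triples x y (p (inord s)) (p (inord t)).
  by rewrite !cE !inordK.
have cH : patterned H6 c H.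
  move=> x y z; rewrite edge3_H6.
  rewrite (even_pair_xor (even_triples x y z (p ord0))) !c2.
  by rewrite (even_pair_xor (@h6_even_pair (c x) (c y) (c z) 0 _ _ _ _)).
exists c => // i.
(* Otherwise some edge of $H_6$ contains both [c (p j)] and [j], which would make [p j], [p j],
   [p m] an edge. *)
have cp j : c (p j) = j.
  apply/eqP/negPn/negP => cj.
  have [m] : exists m : 'I_6, h6 (c (p j)) j m.
    have := h6_pair (ltn_ord (c (p j))) (ltn_ord j) cj.
    case: (pickP (fun m : 'I_6 => h6 (c (p j)) j m)) => [m|none].
      by exists m.
    by rewrite big1 // => m _; rewrite none.
  by rewrite -cE edge3_xxz.
have sums a b : a < 6 -> b < 6 -> a != b ->
    \sum_(l < 6) h6 a b l * #|vclass c l| = k.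
  move=> a6 b6 ab.
  have := card_nb_patterned cH (p (Ordinal a6)) (p (Ordinal b6)).
  rewrite !cp sum_nb_H6 => <-.
  have := h6_pair a6 b6 ab.
  case: (pickP (fun m : 'I_6 => h6 a b m)) => [m habm|none].
    by rewrite (@card_nb_tight _ _ (p m)) ?pE.
  by rewrite big1 // => m _; rewrite none.
pose s l := #|vclass c (inord l)|.
have sE a b : a < 6 -> b < 6 -> a != b ->
    h6 a b 0 * s 0 + h6 a b 1 * s 1 + h6 a b 2 * s 2 + h6 a b 3 * s 3 +
    h6 a b 4 * s 4 + h6 a b 5 * s 5 = k.
  move=> a6 b6 /(sums _ _ a6 b6) <-.
  rewrite [RHS](eq_bigr (fun l : 'I_6 => h6 a b l * s l)) => [|l _].
    by rewrite !big_ord_recr big_ord0 /= add0n.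
  by rewrite /s inord_val.
(* The pairs through 0 give sums of two class sizes along a five-cycle on classes 1 to 5; its odd
   length makes each size half of [k]. The pair 1, 2 involves classes 0 and 5 and settles class
   0. *)
have := (sE 0 1 isT isT isT, sE 0 2 isT isT isT, sE 0 3 isT isT isT,
  sE 0 4 isT isT isT, sE 0 5 isT isT isT, sE 1 2 isT isT isT).
set goal := (X in _ -> X).
cbv -[addn muln s goal] => -[[[[[e1 e2] e3] e4] e5] e12]; rewrite /goal.
have -> : #|vclass c i| = s i by rewrite /s inord_val.
clear - e1 e2 e3 e4 e5 e12; case: i => -[|[|[|[|[|[|?]]]]]] // ?.
all: cbv beta iota delta [nat_of_ord]; lia.
Qed.

Lemma K3_classes x y z :
  (forall x y z a b, h x y z -> h a y z -> h b x z -> h a b z) -> h x y z ->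
  exists2 c : V -> 'I_3, patterned K3 c H & forall i, #|vclass c i| = k.
Proof.
move=> square hxyz.
pose o0 := @Ordinal 3 0 isT; pose o1 := @Ordinal 3 1 isT.
pose o2 := @Ordinal 3 2 isT.
(* A vertex is put in the class of the member of [xyz] that it can replace; [exactly_one] makes this
   well defined. *)
pose c w := if h y z w then o0 else if h x z w then o1 else o2.
have oP i : [\/ i = o0, i = o1 | i = o2].
  by case: i => -[|[|[|?]]] ? //; [apply: Or31|apply: Or32|apply: Or33];
    apply: val_inj.
have c0 w : (c w == o0) = h y z w.
  by rewrite /c; case: (h y z w); case: (h x z w).
have c1 w : (c w == o1) = h x z w.
  by move: (exactly_one w hxyz); rewrite /c; do 3!case: (h _ _ w).
have c2 w : (c w == o2) = h x y w.
  by move: (exactly_one w hxyz); rewrite /c; do 3!case: (h _ _ w).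
have rep i : exists t, c t = i.
  have [->|->|->] := oP i; [exists x|exists y|exists z]; apply/eqP.
  - by rewrite c0; edge_perm.
  - by rewrite c1; edge_perm.
  - by rewrite c2.
have third i j : exists l : 'I_3, (l != i) && (l != j).
  have [->|->|->] := oP i; have [->|->|->] := oP j;
    by [exists o0|exists o1|exists o2].
(* The closing rule in the link of [z] gives [uvz], in the link of [y] it gives [uwy], and in the
   link of [u] it then gives [uvw]. *)
have across u v w : c u = o0 -> c v = o1 -> c w = o2 -> h u v w.
  move/eqP; rewrite c0 => hyzu; move/eqP; rewrite c1 => hxzv.
  move/eqP; rewrite c2 => hxyw.
  have huvz : h u v z by apply: (square x y z) => //; edge_perm.
  have huwy : h u w y by apply: (square x z y); edge_perm.
  have : h w v u by apply: (square z y u); edge_perm.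
  by move=> ?; edge_perm.
have transversal u v w : uniq [:: c u; c v; c w] -> h u v w.
  have [cu|cu|cu] := oP (c u); have [cv|cv|cv] := oP (c v);
    have [cw|cw|cw] := oP (c w); rewrite cu cv cw //= => _.
  - exact: across.
  - by rewrite edge3_23; apply: across.
  - by rewrite edge3_12; apply: across.
  - by rewrite -edge3_rot; apply: across.
  - by rewrite edge3_rot; apply: across.
  - by rewrite edge3_13; apply: across.
(* With [t] in the third class, [wut] and [wvt] are edges, and [wuv] would complete a $K_4^-$ with
   apex [w]. *)
have off u v w : c u = c v -> c w != c u -> h u v w = false.
  move=> cuv cwu; apply/negP => huvw.
  have [l /andP[lu lw]] := third (c u) (c w); have [t ct] := rep l.
  apply: (@no_K4minus w u v t); first by edge_perm.
    by apply: transversal; rewrite /= !inE negb_or ct cwu eq_sym lw eq_sym lu.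
  apply: transversal.
  by rewrite /= !inE negb_or ct -cuv cwu eq_sym lw eq_sym lu.
(* If all three lie in one class, covering a vertex [t] of another class would require an edge
   excluded by [off]. *)
have equal u v w : c u = c v -> h u v w = false.
  move=> cuv; have [cw|] := eqVneq (c w) (c u); last exact: off.
  have [l /andP[lu _]] := third (c u) (c u); have [t ct] := rep l.
  by apply/negP => /(exactly_one t); rewrite !off -?cuv ?cw ?ct.
exists c => [u v w|i].
  rewrite edge3_K3; apply/idP/idP; last exact: transversal.
  apply: contraTT => /=; rewrite !inE andbT negb_and !negbK -orbA.
  move=> /or3P[] /eqP cE; apply: negbT.
  - exact: equal.
  - by rewrite edge3_23 equal.
  - by rewrite edge3_rot equal.
have [->|->|->] := oP i.
- rewrite -(@card_nb_tight y z x); last by edge_perm.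
  by apply: eq_card => w; rewrite !inE c0.
- rewrite -(@card_nb_tight x z y); last by edge_perm.
  by apply: eq_card => w; rewrite !inE c1.
- rewrite -(card_nb_tight hxyz).
  by apply: eq_card => w; rewrite !inE c2.
Qed.

Lemma classification x y z : h x y z ->
  (exists2 c : V -> 'I_3, patterned K3 c H & forall i, #|vclass c i| = k) \/
  (exists2 c : V -> 'I_6, patterned H6 c H & forall i, #|vclass c i| * 2 = k).
Proof.
move=> hxyz; pose nonedge (t : V * V * V * V * V) :=
  let: (x, y, z, a, b) := t in
  [&& h x y z, h a y z, h b x z & ~~ h a b z].
have [[[[[x' y'] z'] a] b]|none] := pickP nonedge.
  move=> /and4P[h1 h2 h3 h4]; right.
  by have [p] := h6_embedding h1 h2 h3 h4; apply: h6_classes.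
left; apply: (K3_classes _ hxyz) => u v w a b h1 h2 h3.
by have := none (u, v, w, a, b); rewrite /= h1 h2 h3 => /negbFE.
Qed.

End Classification.

(** * Uniqueness and conclusion *)

Lemma extremal_classification n (H : hypergraph 3 'I_n) :
  n %% 3 = 0 -> 0 < n -> extremal K4minus H ->
  (exists2 c : 'I_n -> 'I_3, patterned K3 c H &
     forall i, #|vclass c i| = n %/ 3) \/
  (exists2 c : 'I_n -> 'I_6, patterned H6 c H &
     forall i, #|vclass c i| * 2 = n %/ 3).
Proof.
move=> n3 n_gt0 [free mpc]; rewrite coex_K4minus in mpc.
have [x [y [z hxyz]]] : exists x y z, edge3 H x y z.
  by apply: min_pos_codegree_gt0; lia.
apply: (classification free _ _ hxyz) => [u v w|].
  by rewrite -mpc; apply: min_pos_codegree_le.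
by rewrite card_ord; lia.
Qed.

(** Every class has at least [n %/ 3] vertices and the sum leaves no slack. *)
Lemma balanced_vclass_eq n (c : 'I_n -> 'I_3) : n %% 3 = 0 ->
  (forall i j, #|vclass c i| <= #|vclass c j| + 1) ->
  forall i, #|vclass c i| = n %/ 3.
Proof.
move=> n3 bal.
have sum : \sum_i #|vclass c i| = \sum_(i < 3) n %/ 3.
  by rewrite sum_vclass sum_nat_const !card_ord; lia.
have ge i : n %/ 3 <= #|vclass c i| ?= iff (n %/ 3 == #|vclass c i|).
  by split=> //; have := balanced_vclass bal i; rewrite card_ord.
have := (leqif_sum (P := xpredT) (fun i _ => ge i)).2.
by rewrite sum eqxx => /esym/forallP eq i; have /eqP := eq i.
Qed.

Theorem theorem4 (n : nat) (n_gt0 : 0 < n) :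
  [/\ coex n K4minus = n %/ 3,
      n %% 6 = 0 ->
        [/\ exists T : hypergraph 3 'I_n, complete_balanced_tripartite T,
            exists B : hypergraph 3 'I_n, equal_blowup H6 B
          & forall T B : hypergraph 3 'I_n,
              complete_balanced_tripartite T -> equal_blowup H6 B ->
              [/\ extremal K4minus T, extremal K4minus B, ~ isomorphic T B
                & forall H : hypergraph 3 'I_n, extremal K4minus H ->
                    isomorphic H T \/ isomorphic H B]]
    & n %% 6 = 3 ->
        (exists T : hypergraph 3 'I_n, complete_balanced_tripartite T) /\
        (forall T : hypergraph 3 'I_n, complete_balanced_tripartite T ->
           extremal K4minus T /\
           forall H : hypergraph 3 'I_n, extremal K4minus H -> isomorphic H T)].
Proof.
have toT (T H : hypergraph 3 'I_n) (c : 'I_n -> 'I_3) : n %% 3 = 0 ->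
    complete_balanced_tripartite T -> patterned K3 c H ->
    (forall i, #|vclass c i| = n %/ 3) -> isomorphic H T.
  move=> n3 [t [bal /tripartite_patterned Tt]] Hc cE.
  have tE := balanced_vclass_eq n3 bal.
  by apply: (patterned_isomorphic Hc Tt) => i; rewrite cE tE.
split; first exact: coex_K4minus.
  move=> n6; split; [exact: tripartite_exists|exact: equal_blowup_exists|].
  move=> T B Ttri Beq; split.
  - exact: tripartite_extremal.
  - exact: equal_blowup_extremal.
  - exact: tripartite_not_equal_blowup.
  have n3 : n %% 3 = 0 by lia.
  move=> H /(extremal_classification n3 n_gt0)[[c Hc cE]|[c Hc cE]].
    by left; apply: toT Hc cE.
  right; have [b [eqb /blowup_along_patterned Bb]] := Beq.
  apply: (patterned_isomorphic Hc Bb) => i.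
  rewrite (@card_vclass_equal _ _ b (n %/ 6) eqb) ?card_ord; last by lia.
  by apply/eqP; rewrite -(@eqn_pmul2r 2) // cE; apply/eqP; lia.
move=> n6; split=> [|T Ttri]; first exact: tripartite_exists.
split=> [|H]; first exact: tripartite_extremal.
have n3 : n %% 3 = 0 by lia.
move=> /(extremal_classification n3 n_gt0)[[c Hc cE]|[c Hc cE]].
  exact: toT Hc cE.
(* Now [n %/ 3] is odd, so it is not twice a class size. *)
by have := cE ord0; lia.
Qed.
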